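(* Let $\mathcal{S}\subset\mathbb{R}^2$ be a nonempty closed and bounded set, and let $f:\mathbb{R}\to\mathbb{R}$ and $g:\mathbb{R}^2\to\mathbb{R}$ be continuous. For $\lambda\ge 0$ consider the optimization problem $$\max_{x,y}\{\lambda f(x)+g(x,y) : (x,y)\in\mathcal{S}\}.$$ If $f$ is strictly increasing, then $\overline{x}^*(\lambda^1)\le \underline{x}^*(\lambda^2)$ for all $0\le\lambda^1<\lambda^2$.
   Context: Superscripts on $\lambda$ are indices (two different values of $\lambda$), not powers. For $\lambda\ge 0$, $\mathcal{M}(\lambda)\subseteq\mathcal{S}$ denotes the set of all maximizers $(x,y)$ of the optimization problem, and $x^*(\lambda)=\{x : \exists y,\ (x,y)\in\mathcal{M}(\lambda)\}$ is its projection onto the $x$-component. This is a nonempty compact set, and one defines $\overline{x}^*(\lambda)=\max\{x : x\in x^*(\lambda)\}$ and $\underline{x}^*(\lambda)=\min\{x : x\in x^*(\lambda)\}$. *)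

(* Defs.v *)
From mathcomp Require Import all_boot all_order all_algebra.
From mathcomp Require Import all_classical all_reals all_analysis.

Set Implicit Arguments.
Unset Strict Implicit.
Unset Printing Implicit Defensive.

Import Order.TTheory GRing.Theory Num.Theory.
Import numFieldNormedType.Exports.

Local Open Scope classical_set_scope.
Local Open Scope ring_scope.

Definition objective (R : realType) (f : R -> R) (g : R * R -> R) (lambda : R)
    (p : R * R) : R :=
  lambda * f p.1 + g p.

Definition maximizers (R : realType) (S : set (R * R)) (f : R -> R)
    (g : R * R -> R) (lambda : R) : set (R * R) :=
  [set p | S p /\
    forall q, S q -> objective f g lambda q <= objective f g lambda p].

Definition xstar (R : realType) (S : set (R * R)) (f : R -> R)
    (g : R * R -> R) (lambda : R) : set R :=
  [set x | exists y, maximizers S f g lambda (x, y)].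

(* The greatest and the least element of A, required to belong to A (unlike
   [sup] and [inf]). Each is unique when it exists, which is the case for a
   nonempty compact A; otherwise the value is the default 0. *)
Definition set_max (R : realType) (A : set R) : R := xget 0 (A `&` ubound A).

Definition set_min (R : realType) (A : set R) : R := xget 0 (A `&` lbound A).

Definition xstar_max (R : realType) (S : set (R * R)) (f : R -> R)
    (g : R * R -> R) (lambda : R) : R :=
  set_max (xstar S f g lambda).

Definition xstar_min (R : realType) (S : set (R * R)) (f : R -> R)
    (g : R * R -> R) (lambda : R) : R :=
  set_min (xstar S f g lambda).

(* Main.v *)
Require Import Defs.
From mathcomp Require Import all_boot all_order all_algebra.
From mathcomp Require Import all_classical all_reals all_analysis.
From mathcomp Require Import lra.

Set Implicit Arguments.
Unset Strict Implicit.
Unset Printing Implicit Defensive.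

Import Order.TTheory GRing.Theory Num.Theory.
Import numFieldNormedType.Exports.

Local Open Scope classical_set_scope.
Local Open Scope ring_scope.

(** Optimality of (x1, y1) for lambda1 and of (x2, y2) for lambda2 gives, after
    adding the two inequalities, (lambda2 - lambda1) (f x2 - f x1) >= 0, whence
    x1 <= x2 as f is strictly increasing. Compactness of the set of maximizers
    makes the extremal values of x* genuine elements of x*. *)

(** The norm on [R * R] is the maximum of the norms of the components, so a bounded set lies in a
    square, which is compact as a product of two segments. *)
Lemma bounded_closed_compact_prod (R : realType) (A : set (R * R)) :
  bounded_set A -> closed A -> compact A.
Proof.
move=> [M [_ AM]] Acl.
(* Boundedness provides a norm bound for every real strictly above [M], not for [M] itself; hence
   [M + 1]. *)
pose I := [set` `[- (M + 1), M + 1]].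
have Ico : compact I by exact: segment_compact.
apply: (subclosed_compact Acl (compact_setX Ico Ico)) => p Ap.
have /AM/(_ p Ap) : M < M + 1 by rewrite ltrDl.
rewrite /= prod_normE ge_max => /andP[p1 p2].
by split; rewrite /I /= in_itv /= -ler_norml.
Qed.

(** The extreme value theorem for the identity on [A] yields a point of [A] that bounds [A] above,
    so [xget] does not fall back on its default 0. *)
Lemma compact_set_max (R : realType) (A : set R) :
  A !=set0 -> compact A -> A (set_max A).
Proof.
move=> A0 Aco.
have [c /set_mem Ac cmax] : exists2 c, c \in A & forall t, t \in A -> t <= c.
  by apply: (@compact_EVT_max _ _ id) => //; apply: continuous_subspaceT => x; exact: cvg_id.
suff [] : (A `&` ubound A) (set_max A) by [].
by apply: (@xgetPex _ 0); exists c; split=> // t /mem_set/cmax.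
Qed.

Lemma compact_set_min (R : realType) (A : set R) :
  A !=set0 -> compact A -> A (set_min A).
Proof.
move=> A0 Aco.
have [c /set_mem Ac cmin] : exists2 c, c \in A & forall t, t \in A -> c <= t.
  by apply: (@compact_EVT_min _ _ id) => //; apply: continuous_subspaceT => x; exact: cvg_id.
suff [] : (A `&` lbound A) (set_min A) by [].
by apply: (@xgetPex _ 0); exists c; split=> // t /mem_set/cmin.
Qed.

Section maximizers.
Context (R : realType) (S : set (R * R)) (f : R -> R) (g : R * R -> R).

(** In this form, nonemptiness and compactness pass from the maximizers to their projection. *)
Lemma xstar_image (l : R) : xstar S f g l = fst @` maximizers S f g l.
Proof.
apply/seteqP; split=> [x [y xyM]|_ [[x y] xyM <-]]; last by exists y.
by exists (x, y).
Qed.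

Lemma xstar_monotone (l1 l2 x1 x2 : R) : {homo f : x y / x < y} ->
  l1 < l2 -> xstar S f g l1 x1 -> xstar S f g l2 x2 -> x1 <= x2.
Proof.
move=> f_incr l12 [y1 [Sp1 max1]] [y2 [Sp2 max2]].
rewrite leNgt; apply/negP => x21.
(* Each maximizer is tested against the other one, so that the values of [g] cancel in the sum. *)
have := lerD (max1 _ Sp2) (max2 _ Sp1).
rewrite /objective /= leNgt => /negP; apply.
have : 0 < (l2 - l1) * (f x1 - f x2) by rewrite mulr_gt0 // subr_gt0 ?f_incr.
lra.
Qed.

Context (S_neq0 : S !=set0) (S_compact : compact S).
Context (f_cont : continuous f) (g_cont : continuous g).

Lemma objective_continuous (l : R) : continuous (objective f g l).
Proof.
move=> p; apply: cvgD; last exact: g_cont.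
apply: cvgM; first exact: cvg_cst.
by apply: (@cvg_comp _ _ _ fst f _ (nbhs p.1)); [exact: cvg_fst|exact: f_cont].
Qed.

Lemma maximizers_neq0 (l : R) : maximizers S f g l !=set0.
Proof.
have [||c /set_mem Sc cmax] := compact_EVT_max (f := objective f g l) S_neq0.
- exact: S_compact.
- exact/continuous_subspaceT/objective_continuous.
- by exists c; split=> // q /mem_set/cmax.
Qed.

Lemma maximizers_compact (l : R) : compact (maximizers S f g l).
Proof.
apply: (subclosed_compact _ S_compact) => [|p []//].
(* Closedness: the maximizers are the points of [S] lying in every superlevel set of the objective
   at a level attained on [S], and each such set is closed by continuity. *)
rewrite (_ : maximizers _ _ _ _ = S `&` \bigcap_(q in S)
  (objective f g l @^-1` [set x | objective f g l q <= x])); last first.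
  by apply/seteqP; split.
apply: closedI; first exact: compact_closed.
apply: closed_bigI => q _; apply: preimage_closed; last exact: closed_ge.
by move=> p _; exact: objective_continuous.
Qed.

Lemma xstar_neq0 (l : R) : xstar S f g l !=set0.
Proof. by rewrite xstar_image; apply/image_nonempty/maximizers_neq0. Qed.

Lemma xstar_compact (l : R) : compact (xstar S f g l).
Proof.
rewrite xstar_image; apply: continuous_compact; last exact: maximizers_compact.
by apply: continuous_subspaceT => p; exact: cvg_fst.
Qed.

End maximizers.

Theorem theorem2 (R : realType) (S : set (R * R)) (f : R -> R)
    (g : R * R -> R)
    (S_neq0 : S !=set0) (S_closed : closed S) (S_bounded : bounded_set S)
    (f_cont : continuous f) (g_cont : continuous g)
    (f_incr : {homo f : x y / x < y}) :
  forall lambda1 lambda2 : R, 0 <= lambda1 -> lambda1 < lambda2 ->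
    xstar_max S f g lambda1 <= xstar_min S f g lambda2.
Proof.
move=> l1 l2 _ l12.
have S_compact := bounded_closed_compact_prod S_bounded S_closed.
have x_neq0 l : xstar S f g l !=set0 by exact: xstar_neq0.
have x_compact l : compact (xstar S f g l) by exact: xstar_compact.
apply: (xstar_monotone f_incr l12).
- exact: compact_set_max.
- exact: compact_set_min.
Qed.
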